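(* Let $a,c,b_1,b_2\in\mathbb{C}$ with $a,c\notin\{1,2,3,\dots\}$. Then for all $(x,y)\in\mathbb{C}^2$ sufficiently close to $(0,0)$, $$G_2(a,c;b_1,b_2;x,y)=(1+x)^{-b_1}(1+y)^{-b_2}F_2\left(1-c-a;b_1,b_2;1-c,1-a;\frac{x}{x+1},\frac{y}{y+1}\right).$$
   Context: $(q)_n=q(q+1)\cdots(q+n-1)$ for $n\ge1$, $(q)_0=1$, and for $n\ge1$, $(q)_{-n}:=\frac{\Gamma(q-n)}{\Gamma(q)}=\frac{(-1)^n}{(1-q)_n}$ (defined for $q\notin\{1,2,\dots\}$, by the last expression). Horn's function: $G_2(a,c;b_1,b_2;x,y):=\sum_{j,k\ge0}(a)_{j-k}(c)_{k-j}\frac{(b_1)_j(b_2)_k}{j!\,k!}x^jy^k$. Appell's function: $F_2(a;b_1,b_2;c_1,c_2;X,Y):=\sum_{j,k\ge0}\frac{(a)_{j+k}}{j!\,k!}\frac{(b_1)_j(b_2)_k}{(c_1)_j(c_2)_k}X^jY^k$ (for $c_1,c_2\notin\{0,-1,\dots\}$ and $(X,Y)$ near $(0,0)$). Powers $(1+x)^{-b_1}$, $(1+y)^{-b_2}$ are the branches equal to $1$ at $0$. *)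

(* Defs.v *)
From Stdlib Require Import Reals List ZArith.
From Coquelicot Require Import Coquelicot.

Open Scope C_scope.

(** * Pochhammer symbols *)

Fixpoint rising (q : C) (n : nat) : C :=
  match n with
  | O => 1
  | S m => rising q m * (q + RtoC (INR m))
  end.

(** For a negative index [- n] this is [(-1)^n / (1 - q)_n]; it is meaningful
    only when [q] is not a positive integer, since [/ 0] is a junk value. *)
Definition poch (q : C) (m : Z) : C :=
  match m with
  | Z0 => 1
  | Zpos p => rising q (Pos.to_nat p)
  | Zneg p =>
      (RtoC (-1)) ^ (Pos.to_nat p) / rising (1 - q) (Pos.to_nat p)
  end.

(** * Unordered sums of double families

    [is_sum2 u s]: the finite sums of [u] converge to [s] along the finite
    subsets of [nat * nat] ordered by inclusion, such a subset being represented
    by a duplicate-free list.  It suffices to use the boxes [{0..N}^2] as lower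
    bounds, since they are cofinal.  In [C] this is the same as absolute
    convergence with sum [s]. *)

Definition is_sum2 (u : nat -> nat -> C) (s : C) : Prop :=
  forall eps : R, (0 < eps)%R ->
  exists N : nat, forall l : list (nat * nat),
    NoDup l ->
    (forall j k : nat, (j <= N)%nat -> (k <= N)%nat -> In (j, k) l) ->
    (Cmod (fold_right Cplus 0 (map (fun p => u (fst p) (snd p)) l) - s)
       < eps)%R.

Definition ex_sum2 (u : nat -> nat -> C) : Prop := exists s : C, is_sum2 u s.

(** Junk value when the family is not summable. *)
Definition Sum2 (u : nat -> nat -> C) : C :=
  @iota C_CompleteNormedModule (is_sum2 u).

(** * Horn's and Appell's series *)

Definition G2_term (a c b1 b2 x y : C) (j k : nat) : C :=
  poch a (Z.of_nat j - Z.of_nat k) * poch c (Z.of_nat k - Z.of_nat j)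
  * (rising b1 j * rising b2 k / (RtoC (INR (fact j)) * RtoC (INR (fact k))))
  * x ^ j * y ^ k.

Definition G2 (a c b1 b2 x y : C) : C := Sum2 (G2_term a c b1 b2 x y).

Definition F2_term (a b1 b2 c1 c2 X Y : C) (j k : nat) : C :=
  rising a (j + k) / (RtoC (INR (fact j)) * RtoC (INR (fact k)))
  * (rising b1 j * rising b2 k / (rising c1 j * rising c2 k))
  * X ^ j * Y ^ k.

Definition F2 (a b1 b2 c1 c2 X Y : C) : C := Sum2 (F2_term a b1 b2 c1 c2 X Y).

(** * Principal powers *)

Definition Cexp (z : C) : C :=
  RtoC (exp (Re z)) * (cos (Im z), sin (Im z)).

(** Principal argument, with values in (-PI, PI]. *)
Definition Carg (z : C) : R :=
  (if Rlt_dec 0 (Re z) then atan (Im z / Re z)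
   else if Rlt_dec 0 (Im z) then PI / 2 - atan (Re z / Im z)
   else if Rlt_dec (Im z) 0 then - (PI / 2) - atan (Re z / Im z)
   else if Rlt_dec (Re z) 0 then PI
   else 0)%R.

Definition Cln (z : C) : C := (ln (Cmod z), Carg z).

(** As a function of [x], [Cpower (1 + x) b] is analytic on [|x| < 1] and equals
    1 at [x = 0]. *)
Definition Cpower (z b : C) : C := Cexp (b * Cln z).

(* Main.v *)
Require Import Defs.
From Stdlib Require Import Reals List ZArith Lra Lia Classical Permutation.
From Coquelicot Require Import Coquelicot.
Open Scope C_scope.

(** Put [A = 1 - c - a].  In the right-hand side, the term of index [(m, p)]
    contains [x^m (1 + x)^(- b1 - m)] and [y^p (1 + y)^(- b2 - p)].  Expanding
    both by the binomial series ([binomial_series]) turns the right-hand side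
    into a sum over four indices [(m, p), (n, q)].  Since
    [(b)_m (b + m)_n = (b)_(m+n)], the parameters [b1], [b2] and the variables
    enter a term only through [j = m + n] and [k = p + q], in the factor
    [(b1)_j (b2)_k x^j y^k].  Collecting the terms with given [j] and [k] leaves
    the finite sum of
      [(-1)^(j-m+k-p) (A)_(m+p) / (m! p! (j-m)! (k-p)! (1-c)_m (1-a)_p)]
    over [m <= j] and [p <= k], a mixed finite difference of the coefficients of
    the Appell series.  It equals [(a)_(j-k) (c)_(k-j) / (j! k!)], the
    coefficient of the Horn series ([mixed_difference_horn_coef]): by Pascal's
    rule, going from [j] to [j + 1] expresses it by the same sum for the
    parameters [(a, c)] and [(a, c - 1)], and the Horn coefficient obeys the same
    recurrence.

    The rearrangement is legitimate because the fourfold series converges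
    absolutely for small [x] and [y] ([expansion_term_summable]): [(q)_n / n!]
    and its inverse are [O(L^n)] for every [L > 1], and
    [(m + n)! <= 2^(m+n) m! n!].  One unordered sum is then evaluated in two
    ways, by rows ([has_sum_rows]) and along the finite sets on which
    [(m + n, p + q)] is constant ([has_sum_fibres]).  The first evaluation gives
    the right-hand side, the second the Horn series; both summability claims are
    by-products. *)

(** * Unordered summation *)

Definition lsum {I : Type} (u : I -> C) (l : list I) : C :=
  fold_right Cplus 0 (map u l).

(** The unconditional sum over an arbitrary index type; the families that occur
    below are indexed by [nat], by pairs and by pairs of pairs. *)
Definition has_sum {I : Type} (u : I -> C) (s : C) : Prop :=
  forall eps : R, (0 < eps)%R ->
  exists l0 : list I, forall l : list I,
    NoDup l -> incl l0 l -> (Cmod (lsum u l - s) < eps)%R.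

Definition rsum {I : Type} (f : I -> R) (l : list I) : R :=
  fold_right Rplus 0%R (map f l).

Definition bounded_sums {I : Type} (f : I -> R) : Prop :=
  exists M : R, forall l : list I, NoDup l -> (rsum f l <= M)%R.

Lemma lsum_app {I : Type} (u : I -> C) (l l' : list I) :
  lsum u (l ++ l') = lsum u l + lsum u l'.
Proof.
  unfold lsum; induction l as [|i l IH]; simpl; [|rewrite IH]; ring.
Qed.

Lemma lsum_map {I J : Type} (u : J -> C) (h : I -> J) (l : list I) :
  lsum u (map h l) = lsum (fun i => u (h i)) l.
Proof. unfold lsum; now rewrite map_map. Qed.

Lemma lsum_ext {I : Type} (u v : I -> C) (l : list I) :
  (forall i, In i l -> u i = v i) -> lsum u l = lsum v l.
Proof. intros H; unfold lsum; now rewrite (map_ext_in u v). Qed.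

Lemma lsum_plus {I : Type} (u v : I -> C) (l : list I) :
  lsum (fun i => u i + v i) l = lsum u l + lsum v l.
Proof.
  unfold lsum; induction l as [|i l IH]; simpl; [|rewrite IH]; ring.
Qed.

Lemma lsum_scal {I : Type} (z : C) (u : I -> C) (l : list I) :
  lsum (fun i => z * u i) l = z * lsum u l.
Proof.
  unfold lsum; induction l as [|i l IH]; simpl; [|rewrite IH]; ring.
Qed.

Lemma lsum_flat_map {I J : Type} (u : J -> C) (F : I -> list J) (l : list I) :
  lsum u (flat_map F l) = lsum (fun i => lsum u (F i)) l.
Proof.
  induction l as [|i l IH]; simpl; [reflexivity|].
  rewrite lsum_app, IH; reflexivity.
Qed.

Lemma lsum_prod {I J : Type} (u : I * J -> C) (l : list I) (l' : list J) :
  lsum u (list_prod l l') = lsum (fun i => lsum (fun j => u (i, j)) l') l.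
Proof.
  induction l as [|i l IH]; simpl; [reflexivity|].
  rewrite lsum_app, lsum_map, IH; reflexivity.
Qed.

Lemma lsum_exchange {I J : Type} (u : I -> J -> C) (l : list I) (l' : list J) :
  lsum (fun i => lsum (u i) l') l = lsum (fun j => lsum (fun i => u i j) l) l'.
Proof.
  induction l as [|i l IH].
  - unfold lsum at 1; simpl.
    induction l' as [|j l' IH']; [reflexivity|].
    unfold lsum at 1; simpl; fold (lsum (fun j => lsum (fun i => u i j) nil) l').
    rewrite <- IH'; unfold lsum; simpl; ring.
  - unfold lsum at 1; simpl; fold (lsum (fun i => lsum (u i) l') l).
    rewrite IH, <- lsum_plus; reflexivity.
Qed.

Lemma lsum_RtoC {I : Type} (f : I -> R) (l : list I) :
  lsum (fun i => RtoC (f i)) l = RtoC (rsum f l).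
Proof.
  unfold lsum, rsum; induction l as [|i l IH]; simpl; [reflexivity|].
  now rewrite IH, RtoC_plus.
Qed.

Lemma NoDup_superset {I : Type} (l : list I) :
  exists l', NoDup l' /\ incl l l' /\ incl l' l.
Proof.
  induction l as [|i l [l' [nd [sub sup]]]].
  - exists nil; repeat split; auto using NoDup_nil, incl_refl.
  - destruct (classic (In i l')) as [Hi|Hi].
    + exists l'; repeat split; auto.
      * now apply incl_cons.
      * now apply incl_tl.
    + exists (i :: l'); repeat split.
      * now constructor.
      * apply incl_cons; [now left | now apply incl_tl].
      * apply incl_cons; [now left | now apply incl_tl].
Qed.

Lemma incl_permutation {I : Type} (l l' : list I) :
  NoDup l -> incl l l' -> exists r, Permutation l' (l ++ r).
Proof.
  revert l'; induction l as [|i l IH]; intros l' nd sub.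
  - now exists l'.
  - destruct (in_split i l') as [l1 [l2 ->]]; [apply sub; now left|].
    inversion nd as [|? ? Hi nd']; subst.
    destruct (IH (l1 ++ l2)) as [r Hr]; [assumption | |].
    + intros k Hk.
      assert (Hk' : In k (l1 ++ i :: l2)) by (apply sub; now right).
      apply in_app_iff in Hk'; apply in_app_iff.
      destruct Hk' as [?|[->|?]]; [now left | contradiction | now right].
    + exists r; rewrite <- Permutation_middle; simpl; now constructor.
Qed.

Lemma rsum_permutation {I : Type} (f : I -> R) (l l' : list I) :
  Permutation l l' -> rsum f l = rsum f l'.
Proof.
  unfold rsum; induction 1; simpl; [reflexivity | congruence | ring | congruence].
Qed.

Lemma rsum_app {I : Type} (f : I -> R) (l l' : list I) :
  rsum f (l ++ l') = (rsum f l + rsum f l')%R.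
Proof.
  unfold rsum; induction l as [|i l IH]; simpl; [|rewrite IH]; ring.
Qed.

Lemma rsum_nonneg {I : Type} (f : I -> R) (l : list I) :
  (forall i, 0 <= f i)%R -> (0 <= rsum f l)%R.
Proof.
  intros pos; unfold rsum; induction l as [|i l IH]; simpl; [lra|].
  specialize (pos i); lra.
Qed.

Lemma rsum_incl {I : Type} (f : I -> R) (l l' : list I) :
  (forall i, 0 <= f i)%R -> NoDup l -> incl l l' -> (rsum f l <= rsum f l')%R.
Proof.
  intros pos nd sub.
  destruct (incl_permutation l l' nd sub) as [r Hr].
  rewrite (rsum_permutation f _ _ Hr), rsum_app.
  pose proof (rsum_nonneg f r pos); lra.
Qed.

Lemma rsum_le {I : Type} (f g : I -> R) (l : list I) :
  (forall i, f i <= g i)%R -> (rsum f l <= rsum g l)%R.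
Proof.
  intros le; unfold rsum; induction l as [|i l IH]; simpl; [lra|].
  specialize (le i); lra.
Qed.

Lemma rsum_scal {I : Type} (K : R) (f : I -> R) (l : list I) :
  rsum (fun i => (K * f i)%R) l = (K * rsum f l)%R.
Proof.
  unfold rsum; induction l as [|i l IH]; simpl; [|rewrite IH]; ring.
Qed.

Lemma rsum_prod {I J : Type} (f : I -> R) (g : J -> R) l l' :
  rsum (fun p => (f (fst p) * g (snd p))%R) (list_prod l l')
  = (rsum f l * rsum g l')%R.
Proof.
  induction l as [|i l IH]; simpl; [unfold rsum; simpl; ring|].
  rewrite rsum_app, IH.
  replace (rsum f (i :: l)) with (f i + rsum f l)%R by reflexivity.
  rewrite Rmult_plus_distr_r, <- (rsum_scal (f i) g).
  f_equal; unfold rsum; now rewrite map_map.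
Qed.

Lemma bounded_sums_prod {I J : Type} (f : I -> R) (g : J -> R) :
  (forall i, 0 <= f i)%R -> (forall j, 0 <= g j)%R ->
  bounded_sums f -> bounded_sums g ->
  bounded_sums (fun p => (f (fst p) * g (snd p))%R).
Proof.
  intros fpos gpos [M HM] [N HN]; exists (M * N)%R; intros l nd.
  destruct (NoDup_superset (map fst l)) as [l1 [nd1 [sub1 _]]].
  destruct (NoDup_superset (map snd l)) as [l2 [nd2 [sub2 _]]].
  apply Rle_trans with
    (rsum (fun p => (f (fst p) * g (snd p))%R) (list_prod l1 l2)).
  - apply rsum_incl; [|assumption|].
    + intros p; now apply Rmult_le_pos.
    + intros [i j] Hp; apply in_prod_iff; split.
      * apply sub1, (in_map fst l (i, j) Hp).
      * apply sub2, (in_map snd l (i, j) Hp).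
  - rewrite rsum_prod.
    apply Rmult_le_compat; auto using rsum_nonneg.
Qed.

Lemma bounded_sums_le {I : Type} (f g : I -> R) :
  (forall i, f i <= g i)%R -> bounded_sums g -> bounded_sums f.
Proof.
  intros le [M HM]; exists M; intros l nd.
  apply Rle_trans with (rsum g l); auto using rsum_le.
Qed.

Lemma bounded_sums_scal {I : Type} (K : R) (f : I -> R) :
  (0 <= K)%R -> bounded_sums f -> bounded_sums (fun i => (K * f i)%R).
Proof.
  intros HK [M HM]; exists (K * M)%R; intros l nd.
  rewrite rsum_scal; apply Rmult_le_compat_l; auto.
Qed.

Lemma bounded_sums_geometric (q : R) :
  (0 <= q < 1)%R -> bounded_sums (fun n => (q ^ n)%R).
Proof.
  intros Hq; exists (/ (1 - q))%R; intros l nd.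
  assert (Hl : exists N, forall n, In n l -> (n < N)%nat).
  { exists (S (list_max l)); intros n Hn.
    assert (H := proj1 (list_max_le l (list_max l)) (le_n _)).
    rewrite Forall_forall in H; specialize (H n Hn); lia. }
  destruct Hl as [N HN].
  apply Rle_trans with (rsum (fun n => (q ^ n)%R) (seq 0 N)).
  - apply rsum_incl; [intros n; now apply pow_le | assumption |].
    intros n Hn; apply in_seq; specialize (HN n Hn); lia.
  - apply Rmult_le_reg_l with (1 - q)%R; [lra|].
    rewrite Rinv_r by lra.
    assert (E : ((1 - q) * rsum (fun n => q ^ n) (seq 0 N) = 1 - q ^ N)%R).
    { clear; induction N as [|N IH]; [unfold rsum; simpl; ring|].
      rewrite seq_S, rsum_app, Rmult_plus_distr_l, IH; unfold rsum; simpl; ring. }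
    rewrite E; assert (0 <= q ^ N)%R by (apply pow_le; lra); lra.
Qed.

Lemma has_sum_ext {I : Type} (u v : I -> C) (s : C) :
  (forall i, u i = v i) -> has_sum u s -> has_sum v s.
Proof.
  intros E H eps Heps; destruct (H eps Heps) as [l0 Hl0].
  exists l0; intros l nd sub; rewrite (lsum_ext v u); auto.
Qed.

Lemma has_sum_unique {I : Type} (u : I -> C) (s t : C) :
  has_sum u s -> has_sum u t -> s = t.
Proof.
  intros Hs Ht.
  destruct (Req_dec (Cmod (s - t)) 0) as [H|H].
  { apply Cmod_eq_0 in H; now apply Ceq_minus. }
  assert (pos : (0 < Cmod (s - t) / 2)%R) by (pose proof (Cmod_ge_0 (s - t)); lra).
  destruct (Hs _ pos) as [l1 H1], (Ht _ pos) as [l2 H2].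
  destruct (NoDup_superset (l1 ++ l2)) as [l [nd [sub _]]].
  apply incl_app_inv in sub; destruct sub as [sub1 sub2].
  specialize (H1 l nd sub1); specialize (H2 l nd sub2).
  assert (T := Cmod_triangle (lsum u l - t) (- (lsum u l - s))).
  rewrite Cmod_opp in T.
  replace (lsum u l - t + - (lsum u l - s)) with (s - t) in T by ring.
  lra.
Qed.

Lemma has_sum_plus {I : Type} (u v : I -> C) (s t : C) :
  has_sum u s -> has_sum v t -> has_sum (fun i => u i + v i) (s + t).
Proof.
  intros Hu Hv eps Heps.
  destruct (Hu (eps / 2)%R) as [l1 H1]; [lra|].
  destruct (Hv (eps / 2)%R) as [l2 H2]; [lra|].
  exists (l1 ++ l2); intros l nd sub.
  apply incl_app_inv in sub; destruct sub as [sub1 sub2].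
  specialize (H1 l nd sub1); specialize (H2 l nd sub2).
  rewrite lsum_plus.
  replace (lsum u l + lsum v l - (s + t))
    with ((lsum u l - s) + (lsum v l - t)) by ring.
  eapply Rle_lt_trans; [apply Cmod_triangle|]; lra.
Qed.

Lemma has_sum_scal {I : Type} (z : C) (u : I -> C) (s : C) :
  has_sum u s -> has_sum (fun i => z * u i) (z * s).
Proof.
  intros Hu eps Heps.
  assert (pos := Cmod_ge_0 z).
  destruct (Hu (eps / (Cmod z + 1))%R) as [l0 H0].
  { apply Rdiv_lt_0_compat; lra. }
  exists l0; intros l nd sub; specialize (H0 l nd sub).
  rewrite lsum_scal.
  replace (z * lsum u l - z * s) with (z * (lsum u l - s)) by ring.
  rewrite Cmod_mult.
  apply Rle_lt_trans with ((Cmod z + 1) * Cmod (lsum u l - s))%R.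
  - pose proof (Cmod_ge_0 (lsum u l - s)); nra.
  - replace eps with ((Cmod z + 1) * (eps / (Cmod z + 1)))%R by (field; lra).
    apply Rmult_lt_compat_l; lra.
Qed.

Lemma has_sum_nonneg {I : Type} (f : I -> R) :
  (forall i, 0 <= f i)%R -> bounded_sums f ->
  exists s : C, has_sum (fun i => RtoC (f i)) s.
Proof.
  intros pos [M HM].
  destruct (completeness (fun r => exists l, NoDup l /\ r = rsum f l)) as [S [ub lub]].
  - exists M; intros r [l [nd ->]]; now apply HM.
  - exists 0%R, nil; split; [constructor | reflexivity].
  - exists (RtoC S); intros eps Heps.
    destruct (classic (exists l, NoDup l /\ (S - eps < rsum f l)%R)) as [[l0 [nd0 H0]]|none].
    + exists l0; intros l nd sub.
      rewrite lsum_RtoC, <- RtoC_minus, Cmod_R.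
      assert (A := rsum_incl f l0 l pos nd0 sub).
      assert (B : (rsum f l <= S)%R) by (apply ub; now exists l).
      apply Rabs_def1; lra.
    + exfalso; assert (S <= S - eps)%R; [|lra].
      apply lub; intros r [l [nd ->]].
      apply Rnot_lt_le; intros H; apply none; now exists l.
Qed.

Lemma Im_le_Cmod (z : C) : (Rabs (Im z) <= Cmod z)%R.
Proof. eapply Rle_trans; [apply Rmax_r | apply Rmax_Cmod]. Qed.

(** Absolute convergence implies unconditional convergence: shifting the real
    and the imaginary part by [Cmod u] reduces it to nonnegative families, whose
    sums are suprema. *)
Lemma has_sum_abs {I : Type} (u : I -> C) :
  bounded_sums (fun i => Cmod (u i)) -> exists s : C, has_sum u s.
Proof.
  intros bd.
  assert (bd2 := bounded_sums_scal 2 _ ltac:(lra) bd).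
  destruct (has_sum_nonneg (fun i => (Re (u i) + Cmod (u i))%R)) as [s1 H1].
  { intros i; assert (L := re_le_Cmod (u i)); apply Rabs_le_between in L; lra. }
  { eapply bounded_sums_le; [|exact bd2]; intros i; simpl.
    assert (L := re_le_Cmod (u i)); apply Rabs_le_between in L; lra. }
  destruct (has_sum_nonneg (fun i => (Im (u i) + Cmod (u i))%R)) as [s2 H2].
  { intros i; assert (L := Im_le_Cmod (u i)); apply Rabs_le_between in L; lra. }
  { eapply bounded_sums_le; [|exact bd2]; intros i; simpl.
    assert (L := Im_le_Cmod (u i)); apply Rabs_le_between in L; lra. }
  destruct (has_sum_nonneg (fun i => Cmod (u i))) as [s3 H3];
    [intros i; apply Cmod_ge_0 | exact bd |].
  exists (s1 + Ci * s2 + - (1 + Ci) * s3).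
  eapply has_sum_ext;
    [|apply has_sum_plus; [apply has_sum_plus; [exact H1|]|];
      apply has_sum_scal; [exact H2 | exact H3]].
  intros i; simpl.
  rewrite !RtoC_plus.
  transitivity (RtoC (Re (u i)) + Ci * RtoC (Im (u i))); [ring|].
  destruct (u i) as [a b]; unfold Ci, RtoC, Cmult, Cplus; simpl; f_equal; ring.
Qed.

(** Each of finitely many rows is approximated by a finite sum that contains a
    prescribed finite set of columns. *)
Lemma row_approximation {I J : Type} (u : I * J -> C) (r : I -> C) (t : list J) :
  (forall i, has_sum (fun j => u (i, j)) (r i)) ->
  forall l : list I, NoDup l -> forall eps : R, (0 < eps)%R ->
  exists L : list (I * J),
    NoDup L /\ (forall p, In p L -> In (fst p) l) /\
    (forall i j, In i l -> In j t -> In (i, j) L) /\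
    (Cmod (lsum u L - lsum r l) < eps)%R.
Proof.
  intros Hr l; induction l as [|i l IH]; intros nd eps Heps.
  - exists nil; repeat split; auto using NoDup_nil.
    unfold lsum; simpl; replace (0 - 0) with (RtoC 0) by ring.
    now rewrite Cmod_0.
  - inversion nd as [|? ? Hi nd']; subst.
    destruct (IH nd' (eps / 2)%R) as [L [ndL [subL [supL HL]]]]; [lra|].
    destruct (Hr i (eps / 2)%R) as [t0 Ht0]; [lra|].
    destruct (NoDup_superset (t0 ++ t)) as [t' [ndt [subt _]]].
    apply incl_app_inv in subt; destruct subt as [sub0 subt].
    exists (map (fun j => (i, j)) t' ++ L); repeat split.
    + apply NoDup_app; [|assumption|].
      * apply FinFun.Injective_map_NoDup; [|assumption].
        intros j k E; congruence.
      * intros p Hp HpL; apply in_map_iff in Hp; destruct Hp as [j [<- _]].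
        apply subL in HpL; contradiction.
    + intros p Hp; apply in_app_iff in Hp; destruct Hp as [Hp|Hp].
      * apply in_map_iff in Hp; destruct Hp as [j [<- _]]; now left.
      * right; now apply subL.
    + intros k j [->|Hk] Hj; apply in_app_iff.
      * left; apply in_map_iff; exists j; split; [reflexivity | now apply subt].
      * right; now apply supL.
    + rewrite lsum_app, lsum_map.
      replace (lsum r (i :: l)) with (r i + lsum r l) by reflexivity.
      replace (lsum (fun j => u (i, j)) t' + lsum u L - (r i + lsum r l))
        with ((lsum (fun j => u (i, j)) t' - r i) + (lsum u L - lsum r l)) by ring.
      specialize (Ht0 t' ndt sub0).
      eapply Rle_lt_trans; [apply Cmod_triangle|]; lra.
Qed.

(** A finite set of rows that meets every index of [l0] is compared with a finite
    set of indices in these rows that contains [l0] and approximates each row. *)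
Lemma has_sum_rows {I J : Type} (u : I * J -> C) (r : I -> C) (s : C) :
  has_sum u s -> (forall i, has_sum (fun j => u (i, j)) (r i)) -> has_sum r s.
Proof.
  intros Hu Hr eps Heps.
  destruct (Hu (eps / 2)%R) as [l0 H0]; [lra|].
  exists (map fst l0); intros l nd sub.
  destruct (row_approximation u r (map snd l0) Hr l nd (eps / 2)%R)
    as [L [ndL [_ [supL HL]]]]; [lra|].
  specialize (H0 L ndL).
  assert (sub0 : incl l0 L).
  { intros [i j] Hp; apply supL.
    - apply sub, (in_map fst l0 (i, j) Hp).
    - apply (in_map snd l0 (i, j) Hp). }
  specialize (H0 sub0).
  replace (lsum r l - s) with (- (lsum u L - lsum r l) + (lsum u L - s)) by ring.
  eapply Rle_lt_trans; [apply Cmod_triangle|]; rewrite Cmod_opp; lra.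
Qed.

(** Summation along a map with finite fibres: the union of finitely many fibres
    is itself one of the finite sets over which the total sum is a limit. *)
Lemma has_sum_fibres {I K : Type} (u : I -> C) (h : I -> K) (F : K -> list I) (s : C) :
  (forall k, NoDup (F k)) -> (forall k i, In i (F k) <-> h i = k) ->
  has_sum u s -> has_sum (fun k => lsum u (F k)) s.
Proof.
  intros ndF HF Hu eps Heps.
  destruct (Hu eps Heps) as [l0 H0].
  exists (map h l0); intros l nd sub.
  rewrite <- lsum_flat_map; apply H0.
  - clear sub; induction l as [|k l IH]; simpl; [constructor|].
    inversion nd as [|? ? Hk nd']; subst.
    apply NoDup_app; auto.
    intros i Hi Hi'; apply in_flat_map in Hi'; destruct Hi' as [k' [Hk' Hi']].
    apply HF in Hi; apply HF in Hi'; congruence.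
  - intros i Hi; apply in_flat_map; exists (h i); split.
    + apply sub, in_map, Hi.
    + now apply HF.
Qed.

(** The product family is absolutely summable, so it has some sum, and summing
    it by rows identifies that sum. *)
Lemma has_sum_prod {I J : Type} (u : I -> C) (v : J -> C) (s t : C) :
  bounded_sums (fun i => Cmod (u i)) -> bounded_sums (fun j => Cmod (v j)) ->
  has_sum u s -> has_sum v t -> has_sum (fun p => u (fst p) * v (snd p)) (s * t).
Proof.
  intros bu bv Hu Hv.
  destruct (has_sum_abs (fun p : I * J => u (fst p) * v (snd p))) as [w Hw].
  { eapply bounded_sums_le; [|apply (bounded_sums_prod _ _
      (fun i => Cmod_ge_0 (u i)) (fun j => Cmod_ge_0 (v j)) bu bv)].
    intros p; rewrite Cmod_mult; apply Rle_refl. }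
  assert (H : has_sum (fun i => t * u i) w).
  { apply (has_sum_ext (fun i => u i * t)); [intros; ring|].
    eapply has_sum_rows; [exact Hw|].
    intros i; now apply (has_sum_scal (u i) v t). }
  replace (s * t) with w; [assumption|].
  rewrite (Cmult_comm s t); eapply has_sum_unique; [exact H|].
  now apply has_sum_scal.
Qed.

Lemma is_sum2_of_has_sum (u : nat -> nat -> C) (s : C) :
  has_sum (fun p => u (fst p) (snd p)) s -> is_sum2 u s.
Proof.
  intros H eps Heps; destruct (H eps Heps) as [l0 H0].
  exists (list_max (map fst l0) + list_max (map snd l0))%nat.
  intros l nd box; apply H0; [assumption|].
  intros [j k] Hp; apply box.
  - assert (A := proj1 (list_max_le (map fst l0) _) (le_n _)).
    rewrite Forall_forall in A; specialize (A j (in_map fst l0 (j, k) Hp)); lia.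
  - assert (A := proj1 (list_max_le (map snd l0) _) (le_n _)).
    rewrite Forall_forall in A; specialize (A k (in_map snd l0 (j, k) Hp)); lia.
Qed.

Lemma has_sum_of_is_sum2 (u : nat -> nat -> C) (s : C) :
  is_sum2 u s -> has_sum (fun p => u (fst p) (snd p)) s.
Proof.
  intros H eps Heps; destruct (H eps Heps) as [N HN].
  exists (list_prod (seq 0 (S N)) (seq 0 (S N))); intros l nd sub.
  apply HN; [assumption|].
  intros j k Hj Hk; apply sub, in_prod; apply in_seq; lia.
Qed.

Lemma Sum2_of_has_sum (u : nat -> nat -> C) (s : C) :
  has_sum (fun p => u (fst p) (snd p)) s -> Sum2 u = s.
Proof.
  intros H; unfold Sum2; apply (iota_unique (V := C_CompleteNormedModule)).
  - intros t Ht; apply has_sum_of_is_sum2 in Ht.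
    exact (has_sum_unique _ _ _ Ht H).
  - now apply is_sum2_of_has_sum.
Qed.

(** * The binomial series *)

Lemma Cexp_plus (z w : C) : Cexp (z + w) = Cexp z * Cexp w.
Proof.
  destruct z as [a b], w as [c d]; unfold Cexp; simpl.
  rewrite exp_plus, cos_plus, sin_plus.
  unfold Cmult, RtoC; simpl; f_equal; ring.
Qed.

Lemma Cexp_0 : Cexp 0 = 1.
Proof.
  unfold Cexp; simpl; rewrite exp_0, cos_0, sin_0.
  unfold Cmult, RtoC; simpl; f_equal; ring.
Qed.

Lemma Cexp_opp_r (z : C) : Cexp z * Cexp (- z) = 1.
Proof. rewrite <- Cexp_plus; replace (z + - z) with (RtoC 0) by ring; apply Cexp_0. Qed.

Lemma Cexp_neq_0 (z : C) : Cexp z <> 0.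
Proof.
  intros H; apply C1_nz; rewrite <- (Cexp_opp_r z), H; ring.
Qed.

Lemma Cexp_Cln (z : C) : (0 < Re z)%R -> Cexp (Cln z) = z.
Proof.
  intros Hz; destruct z as [a b]; simpl in Hz.
  unfold Cexp, Cln, Carg; simpl.
  destruct (Rlt_dec 0 a) as [_|H]; [|contradiction].
  assert (Hm : (0 < Cmod (a, b))%R).
  { apply Cmod_gt_0; intros E; injection E; intros; lra. }
  rewrite exp_ln by assumption.
  rewrite cos_atan, sin_atan.
  assert (E : Cmod (a, b) = (a * sqrt (1 + (b / a)²))%R).
  { unfold Cmod; simpl.
    replace (a * (a * 1) + b * (b * 1))%R with (a² * (1 + (b / a)²))%R
      by (unfold Rsqr; field; lra).
    rewrite sqrt_mult_alt by apply Rle_0_sqr.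
    now rewrite sqrt_Rsqr by lra. }
  assert (Hs : (0 < sqrt (1 + (b / a)²))%R).
  { apply sqrt_lt_R0; pose proof (Rle_0_sqr (b / a)); lra. }
  rewrite E; unfold Cmult, RtoC; simpl; f_equal; field; lra.
Qed.

(** Together with [(b)_(m+n) = (b)_m (b + m)_n], this turns the row sums of the
    fourfold series into binomial series with shifted parameter. *)
Lemma Cpower_minus_nat (z b : C) (m : nat) :
  (0 < Re z)%R -> Cpower z (- (b + RtoC (INR m))) * z ^ m = Cpower z (- b).
Proof.
  intros Hz; unfold Cpower; induction m as [|m IH].
  - simpl; rewrite Cmult_1_r; do 2 f_equal; ring.
  - rewrite <- IH, S_INR, RtoC_plus; simpl.
    replace (- (b + RtoC (INR m)) * Cln z)
      with (- (b + (RtoC (INR m) + 1)) * Cln z + Cln z) by ring.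
    rewrite Cexp_plus, Cexp_Cln by assumption; ring.
Qed.

Lemma RtoC_neq_0 (x : R) : x <> 0%R -> RtoC x <> 0.
Proof. intros H E; apply H, RtoC_inj, E. Qed.

Lemma INR_fact_C_neq_0 (n : nat) : RtoC (INR (fact n)) <> 0.
Proof. apply RtoC_neq_0, INR_fact_neq_0. Qed.

Lemma Cmod_INR (n : nat) : Cmod (RtoC (INR n)) = INR n.
Proof. rewrite Cmod_R; apply Rabs_pos_eq, pos_INR. Qed.

Lemma fact_S_C (n : nat) :
  RtoC (INR (fact (S n))) = (RtoC (INR n) + 1) * RtoC (INR (fact n)).
Proof. rewrite fact_simpl, mult_INR, RtoC_mult, S_INR, RtoC_plus; reflexivity. Qed.

Lemma fact_S_R (n : nat) : INR (fact (S n)) = ((INR n + 1) * INR (fact n))%R.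
Proof. now rewrite fact_simpl, mult_INR, S_INR. Qed.

(** Finitely many terms do not matter for the growth rate, so the quotients of
    consecutive terms are only bounded from some index on. *)
Lemma ratio_test_bound (L : R) (n0 : nat) :
  (0 < L)%R -> forall u : nat -> R, (forall n, 0 <= u n)%R ->
  (forall n, (n0 <= n)%nat -> (u (S n) <= L * u n)%R) ->
  exists K : R, (0 <= K)%R /\ forall n, (u n <= K * L ^ n)%R.
Proof.
  intros HL; induction n0 as [|n0 IH]; intros u pos H.
  - exists (u 0%nat); split; [apply pos|].
    induction n as [|n IH]; simpl; [lra|].
    specialize (H n (Nat.le_0_l n)); nra.
  - destruct (IH (fun n => u (S n))) as [K [HK H']].
    + intros n; apply pos.
    + intros n Hn; apply H; lia.
    + exists (Rmax (u 0%nat) (K / L)); split.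
      * eapply Rle_trans; [apply (pos 0%nat) | apply Rmax_l].
      * intros [|n]; [simpl; rewrite Rmult_1_r; apply Rmax_l|].
        eapply Rle_trans; [apply H'|].
        replace (K * L ^ n)%R with (K / L * L ^ S n)%R by (simpl; field; lra).
        apply Rmult_le_compat_r; [apply pow_le; lra | apply Rmax_r].
Qed.

(** The quotient [|q + n| / (n + 1)] of consecutive terms tends to 1. *)
Lemma rising_growth (q : C) (L : R) :
  (1 < L)%R ->
  exists K : R, (0 <= K)%R /\
  forall n, (Cmod (rising q n) <= K * L ^ n * INR (fact n))%R.
Proof.
  intros HL.
  destruct (nfloor_ex (Cmod q / (L - 1))) as [n0 [_ Hn0]].
  { apply Rdiv_le_0_compat; [apply Cmod_ge_0 | lra]. }
  destruct (ratio_test_bound L (S n0) ltac:(lra)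
    (fun n => Cmod (rising q n) / INR (fact n))%R) as [K [HK H]].
  - intros n; apply Rdiv_le_0_compat; [apply Cmod_ge_0 | apply INR_fact_lt_0].
  - intros n Hn; rewrite fact_S_R; simpl rising; rewrite Cmod_mult.
    assert (Hf := INR_fact_lt_0 n); assert (Hn' := pos_INR n).
    assert (T := Cmod_triangle q (RtoC (INR n))); rewrite Cmod_INR in T.
    assert (Hq : (Cmod q <= (L - 1) * INR n)%R).
    { apply le_INR in Hn; rewrite S_INR in Hn.
      replace (Cmod q) with ((L - 1) * (Cmod q / (L - 1)))%R by (field; lra).
      apply Rmult_le_compat_l; lra. }
    apply Rmult_le_reg_r with ((INR n + 1) * INR (fact n))%R; [nra|].
    replace (Cmod (rising q n) * Cmod (q + RtoC (INR n)) / ((INR n + 1) * INR (fact n))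
              * ((INR n + 1) * INR (fact n)))%R
      with (Cmod (rising q n) * Cmod (q + RtoC (INR n)))%R by (field; lra).
    replace (L * (Cmod (rising q n) / INR (fact n)) * ((INR n + 1) * INR (fact n)))%R
      with (Cmod (rising q n) * (L * (INR n + 1)))%R by (field; lra).
    apply Rmult_le_compat_l; [apply Cmod_ge_0 | lra].
  - exists K; split; [assumption|]; intros n; assert (Hf := INR_fact_lt_0 n).
    apply Rmult_le_reg_r with (/ INR (fact n))%R; [now apply Rinv_0_lt_compat|].
    eapply Rle_trans; [apply H | right; field; lra].
Qed.

Lemma rising_neq_0 (q : C) (n : nat) :
  (forall i : nat, q + RtoC (INR i) <> 0) -> rising q n <> 0.
Proof.
  intros H; induction n as [|n IH]; [apply C1_nz | now apply Cmult_neq_0].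
Qed.

Lemma rising_inv_growth (q : C) (L : R) :
  (1 < L)%R -> (forall i : nat, q + RtoC (INR i) <> 0) ->
  exists K : R, (0 <= K)%R /\
  forall n, (/ Cmod (rising q n) <= K * L ^ n * / INR (fact n))%R.
Proof.
  intros HL nz.
  assert (Hq0 := Cmod_ge_0 q).
  destruct (nfloor_ex ((1 + L * Cmod q) / (L - 1))) as [n0 [_ Hn0]].
  { apply Rdiv_le_0_compat; nra. }
  assert (rpos : forall n, (0 < Cmod (rising q n))%R).
  { intros n; now apply Cmod_gt_0, rising_neq_0. }
  destruct (ratio_test_bound L (S n0) ltac:(lra)
    (fun n => INR (fact n) / Cmod (rising q n))%R) as [K [HK H]].
  - intros n; apply Rdiv_le_0_compat; [apply pos_INR | apply rpos].
  - intros n Hn; rewrite fact_S_R; simpl rising; rewrite Cmod_mult.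
    assert (Hf := INR_fact_lt_0 n); assert (Hr := rpos n).
    assert (Hs := proj1 (Cmod_gt_0 _) (nz n)).
    assert (T := Cmod_triangle (q + RtoC (INR n)) (- q)); rewrite Cmod_opp in T.
    replace (q + RtoC (INR n) + - q) with (RtoC (INR n)) in T by ring.
    rewrite Cmod_INR in T.
    assert (Hq : (1 + L * Cmod q <= (L - 1) * INR n)%R).
    { apply le_INR in Hn; rewrite S_INR in Hn.
      replace (1 + L * Cmod q)%R
        with ((L - 1) * ((1 + L * Cmod q) / (L - 1)))%R by (field; lra).
      apply Rmult_le_compat_l; lra. }
    set (s := Cmod (q + RtoC (INR n))) in *; set (r := Cmod (rising q n)) in *.
    apply Rmult_le_reg_r with (r * s)%R; [nra|].
    replace ((INR n + 1) * INR (fact n) / (r * s) * (r * s))%R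
      with (INR (fact n) * (INR n + 1))%R by (field; lra).
    replace (L * (INR (fact n) / r) * (r * s))%R
      with (INR (fact n) * (L * s))%R by (field; lra).
    apply Rmult_le_compat_l; nra.
  - exists K; split; [assumption|]; intros n.
    assert (Hf := INR_fact_lt_0 n); assert (Hr := rpos n).
    apply Rmult_le_reg_r with (INR (fact n)); [assumption|].
    eapply Rle_trans; [|eapply Rle_trans; [apply (H n)|]]; right; field; lra.
Qed.

Definition binomial_term (q x : C) (n : nat) : C :=
  rising q n * RtoC (-1) ^ n / RtoC (INR (fact n)) * x ^ n.

Lemma binomial_term_bound (q x : C) :
  (Cmod x < 1)%R ->
  exists K rho : R, (0 <= K)%R /\ (0 < rho < 1)%R /\
  forall n, (Cmod (binomial_term q x n) <= K * rho ^ n)%R.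
Proof.
  intros Hx; assert (Hx0 := Cmod_ge_0 x).
  (* Any L with 1 < L < 1 / Cmod x would do. *)
  set (L := (2 / (1 + Cmod x))%R).
  assert (HL : (1 < L)%R).
  { unfold L; apply Rmult_lt_reg_r with (1 + Cmod x)%R; [lra|].
    replace (2 / (1 + Cmod x) * (1 + Cmod x))%R with 2%R by (field; lra); lra. }
  destruct (rising_growth q L HL) as [K [HK H]].
  exists K, ((1 + Cmod x) / 2)%R; repeat split; [assumption | lra | lra |].
  intros n; unfold binomial_term, Cdiv.
  assert (Hf := INR_fact_lt_0 n).
  rewrite !Cmod_mult, Cmod_inv by apply INR_fact_C_neq_0.
  rewrite !Cmod_pow, Cmod_INR, Cmod_R.
  replace (Rabs (-1)) with 1%R by (rewrite Rabs_left; lra).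
  rewrite pow1.
  apply Rle_trans with (K * (L * Cmod x) ^ n)%R.
  - rewrite Rpow_mult_distr, <- Rmult_assoc.
    apply Rmult_le_compat_r; [now apply pow_le|].
    apply Rmult_le_reg_r with (INR (fact n)); [assumption|].
    replace (Cmod (rising q n) * 1 * / INR (fact n) * INR (fact n))%R
      with (Cmod (rising q n)) by (field; lra).
    apply H.
  - apply Rmult_le_compat_l; [assumption|].
    apply pow_incr; split; [apply Rmult_le_pos; lra|].
    unfold L; apply Rmult_le_reg_r with (2 * (1 + Cmod x))%R; [lra|].
    replace (2 / (1 + Cmod x) * Cmod x * (2 * (1 + Cmod x)))%R
      with (4 * Cmod x)%R by (field; lra).
    replace ((1 + Cmod x) / 2 * (2 * (1 + Cmod x)))%R
      with ((1 + Cmod x) * (1 + Cmod x))%R by field.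
    pose proof (Rle_0_sqr (1 - Cmod x)); unfold Rsqr in *; nra.
Qed.

Lemma binomial_term_S (q x : C) (n : nat) :
  RtoC (INR n + 1) * binomial_term q x (S n)
  = - ((q + RtoC (INR n)) * x * binomial_term q x n).
Proof.
  unfold binomial_term; rewrite fact_S_C, RtoC_plus; simpl.
  assert (H := INR_fact_C_neq_0 n).
  assert (H1 : RtoC (INR n) + 1 <> 0).
  { rewrite <- RtoC_plus; apply RtoC_neq_0; pose proof (pos_INR n); lra. }
  replace (RtoC (-1)) with (- (1)) by (rewrite <- RtoC_opp; f_equal; ring).
  field; auto.
Qed.

Lemma CV_radius_gt_1 (a : nat -> R) (K rho : R) :
  (0 < rho < 1)%R -> (forall n, Rabs (a n) <= K * rho ^ n)%R ->
  Rbar_lt 1 (CV_radius a).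
Proof.
  intros Hrho Ha.
  apply Rbar_lt_le_trans with (Finite (/ rho)).
  - simpl; rewrite <- Rinv_1; apply Rinv_lt_contravar; lra.
  - apply (CV_radius_bounded a); exists K; intros n.
    rewrite Rabs_mult, <- RPow_abs, (Rabs_pos_eq (/ rho))
      by (left; apply Rinv_0_lt_compat; lra).
    apply Rle_trans with (K * rho ^ n * (/ rho) ^ n)%R.
    + apply Rmult_le_compat_r; [|apply Ha].
      apply pow_le; left; apply Rinv_0_lt_compat; lra.
    + rewrite Rmult_assoc, <- Rpow_mult_distr, Rinv_r, pow1 by lra; lra.
Qed.

(** The derivative of [exp (q l) s] is [exp (q l) (q l' s + s')]. *)
Lemma is_derive_Cexp_mult (q : C) (l1 l2 s1 s2 : R -> R) (t dl1 dl2 ds1 ds2 : R) :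
  is_derive l1 t dl1 -> is_derive l2 t dl2 ->
  is_derive s1 t ds1 -> is_derive s2 t ds2 ->
  q * (dl1, dl2) * (s1 t, s2 t) + (ds1, ds2) = 0 ->
  is_derive (fun t => Re (Cexp (q * (l1 t, l2 t)) * (s1 t, s2 t))) t 0%R /\
  is_derive (fun t => Im (Cexp (q * (l1 t, l2 t)) * (s1 t, s2 t))) t 0%R.
Proof.
  intros H1 H2 H3 H4 E.
  destruct q as [q1 q2]; unfold Cexp; simpl.
  unfold Cmult, Cplus, RtoC in E; simpl in E; injection E; intros E2 E1.
  assert (D1 := is_derive_unique _ _ _ H1).
  assert (D2 := is_derive_unique _ _ _ H2).
  assert (D3 := is_derive_unique _ _ _ H3).
  assert (D4 := is_derive_unique _ _ _ H4).
  assert (X1 : ex_derive l1 t) by now exists dl1.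
  assert (X2 : ex_derive l2 t) by now exists dl2.
  assert (X3 : ex_derive s1 t) by now exists ds1.
  assert (X4 : ex_derive s2 t) by now exists ds2.
  replace ds1 with (- ((q1 * dl1 - q2 * dl2) * s1 t - (q1 * dl2 + q2 * dl1) * s2 t))%R
    in D3 by lra.
  replace ds2 with (- ((q1 * dl1 - q2 * dl2) * s2 t + (q1 * dl2 + q2 * dl1) * s1 t))%R
    in D4 by lra.
  split; auto_derive; try (repeat split; assumption);
    change (Derive (fun x => l1 x)) with (Derive l1);
    change (Derive (fun x => l2 x)) with (Derive l2);
    change (Derive (fun x => s1 x)) with (Derive s1);
    change (Derive (fun x => s2 x)) with (Derive s2);
    rewrite D1, D2, D3, D4; ring.
Qed.

Lemma is_derive_Cln_ray (x1 x2 t : R) :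
  (0 < 1 + t * x1)%R ->
  let N := ((1 + t * x1) ^ 2 + (t * x2) ^ 2)%R in
  is_derive (fun t => ln (sqrt ((1 + t * x1) ^ 2 + (t * x2) ^ 2))) t
    (((1 + t * x1) * x1 + t * x2 * x2) / N)%R /\
  is_derive (fun t => atan (t * x2 / (1 + t * x1))) t (x2 / N)%R.
Proof.
  intros H N.
  assert (HN : (0 < N)%R).
  { unfold N; pose proof (Rle_0_sqr (t * x2)); unfold Rsqr in *; nra. }
  assert (Hs := sqrt_lt_R0 _ HN).
  split.
  - auto_derive.
    + fold N; auto.
    + change ((1 + t * x1) * ((1 + t * x1) * 1) + t * x2 * (t * x2 * 1))%R with N.
      assert (E : N = (sqrt N * sqrt N)%R) by (symmetry; apply sqrt_sqrt; lra).
      unfold Rdiv; rewrite E at 3; field; lra.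
  - auto_derive; [lra|].
    unfold N; field; fold N; split; lra.
Qed.

(** [p] stands for the real or the imaginary part. *)
Lemma has_sum_is_series (a : nat -> C) (s : C) (p : C -> R) :
  (forall z w : C, p (z + w) = (p z + p w)%R) -> (forall z : C, Rabs (p z) <= Cmod z)%R ->
  has_sum a s -> is_series (fun n => p (a n)) (p s).
Proof.
  intros padd ple H.
  assert (pminus : forall z w : C, p (z - w) = (p z - p w)%R).
  { intros z w; assert (E := padd (z - w) w).
    replace (z - w + w) with z in E by ring; lra. }
  assert (E : forall n, sum_n (fun n => p (a n)) n = p (lsum a (seq 0 (S n)))).
  { induction n as [|n IH].
    - rewrite sum_O; unfold lsum; simpl; now rewrite Cplus_0_r.
    - rewrite sum_Sn, IH, (seq_S (S n)), lsum_app, padd; simpl.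
      unfold lsum at 3; simpl; now rewrite Cplus_0_r. }
  change (is_lim_seq (sum_n (fun n => p (a n))) (Finite (p s))).
  apply is_lim_seq_spec; intros eps.
  destruct (H eps (cond_pos eps)) as [l0 H0].
  exists (list_max l0); intros n Hn.
  rewrite E, <- pminus.
  eapply Rle_lt_trans; [apply ple|]; apply H0; [apply seq_NoDup|].
  intros i Hi; apply in_seq.
  assert (A := proj1 (list_max_le l0 _) (le_n _)).
  rewrite Forall_forall in A; specialize (A i Hi); lia.
Qed.

Lemma binomial_term_summable (q x : C) :
  (Cmod x < 1)%R -> bounded_sums (fun n => Cmod (binomial_term q x n)).
Proof.
  intros Hx; destruct (binomial_term_bound q x Hx) as [K [rho [HK [Hrho H]]]].
  eapply bounded_sums_le; [exact H|].
  apply bounded_sums_scal; [assumption|].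
  apply bounded_sums_geometric; lra.
Qed.

(** A power series [s] in [t] with complex coefficients satisfying
    [(1 + t x) s' = - w s] gives two real equations, for the real and for the
    imaginary part of [s].  This is either of them: [a] is the part considered, [b] the other
    one, and the signs of [x2] and [w2] depend on the choice. *)
Lemma PSeries_ODE (a b : nat -> R) (x1 x2 w1 w2 t : R) :
  Rbar_lt (Rabs t) (CV_radius a) -> Rbar_lt (Rabs t) (CV_radius b) ->
  (forall n, INR (S n) * a (S n)
     = - (x1 * (INR n * a n) + x2 * (INR n * b n)) - (w1 * a n + w2 * b n))%R ->
  PSeries (PS_derive a) t
  = (- (x1 * (t * PSeries (PS_derive a) t) + x2 * (t * PSeries (PS_derive b) t))
     - (w1 * PSeries a t + w2 * PSeries b t))%R.
Proof.
  intros Ha Hb E.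
  assert (A := PSeries_correct _ _ (CV_radius_inside _ _ Ha)).
  assert (B := PSeries_correct _ _ (CV_radius_inside _ _ Hb)).
  assert (A' := PSeries_correct _ _ (ex_pseries_derive _ _ Ha)).
  assert (B' := PSeries_correct _ _ (ex_pseries_derive _ _ Hb)).
  apply is_pseries_unique.
  assert (cm : forall u v : R, mult u v = mult v u) by (intros; apply Rmult_comm).
  assert (P := is_pseries_plus _ _ _ _ _
    (is_pseries_plus _ _ _ _ _
      (is_pseries_scal (- x1)%R _ _ _ (cm _ _) (is_pseries_incr_1 _ _ _ A'))
      (is_pseries_scal (- x2)%R _ _ _ (cm _ _) (is_pseries_incr_1 _ _ _ B')))
    (is_pseries_plus _ _ _ _ _
      (is_pseries_scal (- w1)%R _ _ _ (cm _ _) A)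
      (is_pseries_scal (- w2)%R _ _ _ (cm _ _) B))).
  match type of P with is_pseries _ _ ?v =>
    match goal with |- is_pseries _ _ ?w => replace w with v end end.
  - eapply is_pseries_ext; [|exact P].
    intros n; unfold PS_derive; rewrite E.
    unfold PS_plus, PS_scal, PS_incr_1, scal, plus, mult; simpl; unfold mult; simpl.
    destruct n as [|n]; simpl; unfold zero; simpl; ring.
  - unfold scal, plus, mult; simpl; unfold mult; simpl; ring.
Qed.

(** Along the ray [t x] with [0 <= t <= 1] the series solves the linear
    differential equation of [(1 + t x)^(-q)], hence the product of the series
    and [(1 + t x)^q] is constant. *)
Theorem binomial_series (q x : C) :
  (Cmod x < 1)%R -> has_sum (binomial_term q x) (Cpower (1 + x) (- q)).
Proof.
  intros Hx.
  destruct (has_sum_abs _ (binomial_term_summable q x Hx)) as [s HS].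
  replace (Cpower (1 + x) (- q)) with s; [assumption|].
  set (a := fun n => Re (binomial_term q x n)).
  set (b := fun n => Im (binomial_term q x n)).
  destruct (binomial_term_bound q x Hx) as [K [rho [HK [Hrho Hbd]]]].
  assert (Ra : Rbar_lt 1 (CV_radius a)).
  { apply (CV_radius_gt_1 a K rho Hrho); intros n.
    eapply Rle_trans; [apply re_le_Cmod | apply Hbd]. }
  assert (Rb : Rbar_lt 1 (CV_radius b)).
  { apply (CV_radius_gt_1 b K rho Hrho); intros n.
    eapply Rle_trans; [apply Im_le_Cmod | apply Hbd]. }
  destruct x as [x1 x2] eqn:Ex; destruct q as [q1 q2] eqn:Eq.
  assert (Hx1 : (Rabs x1 < 1)%R).
  { eapply Rle_lt_trans; [apply (re_le_Cmod (x1, x2)) | assumption]. }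
  apply Rabs_lt_between in Hx1.
  set (l1 := fun t => ln (sqrt ((1 + t * x1) ^ 2 + (t * x2) ^ 2))).
  set (l2 := fun t => atan (t * x2 / (1 + t * x1))%R).
  assert (rec : (forall n,
    (INR n + 1) * a (S n)
      = - (x1 * (INR n * a n) + - x2 * (INR n * b n))
        - ((q1 * x1 - q2 * x2) * a n + - (q1 * x2 + q2 * x1) * b n) /\
    (INR n + 1) * b (S n)
      = - (x1 * (INR n * b n) + x2 * (INR n * a n))
        - ((q1 * x1 - q2 * x2) * b n + (q1 * x2 + q2 * x1) * a n))%R).
  { intros n; assert (E := binomial_term_S q x n).
    rewrite Ex, Eq in E; unfold a, b.
    destruct (binomial_term (q1, q2) (x1, x2) (S n)) as [c d].
    destruct (binomial_term (q1, q2) (x1, x2) n) as [e f].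
    unfold Cmult, Cplus, Copp, RtoC in E; simpl in E; injection E; intros E2 E1.
    simpl; split; lra. }
  assert (der : forall t, (0 <= t <= 1)%R ->
    is_derive (fun t => Re (Cexp (q * (l1 t, l2 t)) * (PSeries a t, PSeries b t))) t 0%R /\
    is_derive (fun t => Im (Cexp (q * (l1 t, l2 t)) * (PSeries a t, PSeries b t))) t 0%R).
  { intros t Ht.
    assert (Hta : Rbar_lt (Rabs t) (CV_radius a)).
    { apply Rbar_le_lt_trans with 1%R; [|assumption]; simpl; rewrite Rabs_pos_eq; lra. }
    assert (Htb : Rbar_lt (Rabs t) (CV_radius b)).
    { apply Rbar_le_lt_trans with 1%R; [|assumption]; simpl; rewrite Rabs_pos_eq; lra. }
    assert (Hpos : (0 < 1 + t * x1)%R) by nra.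
    destruct (is_derive_Cln_ray x1 x2 t Hpos) as [D1 D2].
    eapply (is_derive_Cexp_mult q l1 l2 _ _ t _ _ _ _ D1 D2
              (is_derive_PSeries _ _ Hta) (is_derive_PSeries _ _ Htb)).
    assert (O1 := PSeries_ODE a b x1 (- x2) (q1 * x1 - q2 * x2) (- (q1 * x2 + q2 * x1))
      t Hta Htb ltac:(intros n; rewrite S_INR; apply (rec n))).
    assert (O2 := PSeries_ODE b a x1 x2 (q1 * x1 - q2 * x2) (q1 * x2 + q2 * x1)
      t Htb Hta ltac:(intros n; rewrite S_INR; apply (rec n))).
    set (N := ((1 + t * x1) ^ 2 + (t * x2) ^ 2)%R).
    set (A := PSeries (PS_derive a) t) in *; set (B := PSeries (PS_derive b) t) in *.
    assert (HN : (0 < N)%R).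
    { unfold N; pose proof (Rle_0_sqr (t * x2)); unfold Rsqr in *; nra. }
    assert (Hz : (1 + t * x1, t * x2)%R <> RtoC 0).
    { intros E; injection E; intros; lra. }
    assert (EL : (((1 + t * x1) * x1 + t * x2 * x2) / N, x2 / N)%R
                 = (x1, x2) / (1 + t * x1, t * x2)%R).
    { unfold Cdiv, Cinv, Cmult; simpl.
      change ((1 + t * x1) * ((1 + t * x1) * 1) + t * x2 * (t * x2 * 1))%R with N.
      f_equal; field; lra. }
    rewrite EL.
    assert (EO : (1 + t * x1, t * x2)%R * (A, B)
                 = - (q * (x1, x2) * (PSeries a t, PSeries b t))).
    { rewrite Eq; unfold Cmult, Copp; simpl; f_equal; lra. }
    set (z := (1 + t * x1, t * x2)%R) in *.
    replace ((A, B) : C) with (z * (A, B) / z) by (field; assumption).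
    rewrite EO; field; assumption. }
  assert (fin : Cexp (q * (l1 1, l2 1)%R) * (PSeries a 1, PSeries b 1) = 1).
  { assert (E1 := eq_is_derive
      (fun t => Re (Cexp (q * (l1 t, l2 t)) * (PSeries a t, PSeries b t))) 0 1
      (fun t Ht => proj1 (der t Ht)) Rlt_0_1).
    assert (E2 := eq_is_derive
      (fun t => Im (Cexp (q * (l1 t, l2 t)) * (PSeries a t, PSeries b t))) 0 1
      (fun t Ht => proj2 (der t Ht)) Rlt_0_1).
    cbv beta in E1, E2.
    assert (start : Cexp (q * (l1 0, l2 0)%R) * (PSeries a 0, PSeries b 0) = 1).
    { rewrite !PSeries_0; unfold l1, l2, a, b.
      replace (ln (sqrt ((1 + 0 * x1) ^ 2 + (0 * x2) ^ 2))) with 0%R.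
      2:{ replace ((1 + 0 * x1) ^ 2 + (0 * x2) ^ 2)%R with 1%R by ring.
          now rewrite sqrt_1, ln_1. }
      replace (0 * x2 / (1 + 0 * x1))%R with 0%R by (field; lra).
      rewrite atan_0.
      change ((0, 0)%R : C) with (RtoC 0); rewrite Cmult_0_r, Cexp_0.
      replace (binomial_term (q1, q2) (x1, x2) 0) with (RtoC 1)
        by (unfold binomial_term; simpl; field; apply C1_nz).
      apply Cmult_1_l. }
    rewrite start in E1, E2.
    rewrite (surjective_pairing (Cexp _ * _)).
    unfold Re, Im in E1, E2; rewrite <- E1, <- E2; reflexivity. }
  assert (val : (PSeries a 1, PSeries b 1)%R = s).
  { assert (SA := has_sum_is_series _ _ Re (fun _ _ => eq_refl) re_le_Cmod HS).
    assert (SB := has_sum_is_series _ _ Im (fun _ _ => eq_refl) Im_le_Cmod HS).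
    rewrite (surjective_pairing s); f_equal; apply is_pseries_unique, is_pseries_R.
    - eapply is_series_ext; [|exact SA]; intros n; unfold a; now rewrite pow1, Rmult_1_r.
    - eapply is_series_ext; [|exact SB]; intros n; unfold b; now rewrite pow1, Rmult_1_r. }
  assert (log : (l1 1, l2 1)%R = Cln (1 + (x1, x2))).
  { unfold Cln, Carg, l1, l2, Cmod; simpl.
    destruct (Rlt_dec 0 (1 + x1)) as [_|H]; [|exfalso; lra].
    rewrite !Rmult_1_l, Rplus_0_l; reflexivity. }
  rewrite val, log in fin; unfold Cpower.
  transitivity (Cexp (q * Cln (1 + (x1, x2))) * s * Cexp (- (q * Cln (1 + (x1, x2))))).
  - rewrite <- Cmult_assoc, (Cmult_comm s), Cmult_assoc, Cexp_opp_r; ring.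
  - rewrite fin, Eq, Cmult_1_l; f_equal; ring.
Qed.

(** * The coefficient identity *)

Definition not_positive_integer (a : C) : Prop :=
  forall n : nat, (1 <= n)%nat -> a <> RtoC (INR n).

Lemma not_positive_integer_pred (a : C) :
  not_positive_integer a -> not_positive_integer (a - 1).
Proof.
  intros H n Hn E; apply (H (S n)); [lia|].
  rewrite S_INR, RtoC_plus, <- E; ring.
Qed.

Lemma one_minus_plus_neq_0 (a : C) (i : nat) :
  not_positive_integer a -> 1 - a + RtoC (INR i) <> 0.
Proof.
  intros H E; apply (H (S i)); [lia|].
  rewrite S_INR, RtoC_plus.
  replace (RtoC (INR i)) with (- (1 - a)); [ring|].
  symmetry; apply Ceq_minus; rewrite <- E; ring.
Qed.

Lemma rising_one_minus_neq_0 (a : C) (n : nat) :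
  not_positive_integer a -> rising (1 - a) n <> 0.
Proof.
  intros H; apply rising_neq_0; intros i; now apply one_minus_plus_neq_0.
Qed.

Lemma rising_plus (q : C) (m n : nat) :
  rising q (m + n) = rising q m * rising (q + RtoC (INR m)) n.
Proof.
  induction n as [|n IH]; simpl.
  - rewrite Nat.add_0_r; ring.
  - rewrite Nat.add_succ_r; simpl; rewrite IH, plus_INR, RtoC_plus; ring.
Qed.

Lemma rising_S_l (q : C) (n : nat) : rising q (S n) = q * rising (q + 1) n.
Proof.
  change (S n) with (1 + n)%nat; rewrite rising_plus; simpl.
  replace (q + RtoC 0) with q by ring; ring.
Qed.

Lemma poch_nat (q : C) (n : nat) : poch q (Z.of_nat n) = rising q n.
Proof.
  destruct n as [|n]; [reflexivity|].
  cbn [Z.of_nat poch]; now rewrite SuccNat2Pos.id_succ.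
Qed.

Lemma poch_opp_nat (q : C) (n : nat) :
  poch q (- Z.of_nat n) = RtoC (-1) ^ n / rising (1 - q) n.
Proof.
  destruct n as [|n].
  - simpl; field; apply C1_nz.
  - cbn [Z.of_nat poch Z.opp]; now rewrite SuccNat2Pos.id_succ.
Qed.

Lemma RtoC_m1 : RtoC (-1) = - (1).
Proof. rewrite <- RtoC_opp; f_equal; ring. Qed.

Lemma poch_succ (q : C) (m : Z) :
  not_positive_integer q ->
  poch q (m + 1) = poch q m * (q + RtoC (IZR m)).
Proof.
  intros H; destruct (Z_lt_le_dec m 0) as [Hm|Hm].
  - assert (E : exists n, m = (- Z.of_nat (S n))%Z).
    { exists (Z.to_nat (- m - 1)); lia. }
    destruct E as [n ->].
    replace (- Z.of_nat (S n) + 1)%Z with (- Z.of_nat n)%Z by lia.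
    rewrite !poch_opp_nat, opp_IZR, <- INR_IZR_INZ, S_INR, RtoC_opp, RtoC_plus.
    simpl; rewrite RtoC_m1.
    field; split.
    + now apply one_minus_plus_neq_0.
    + now apply rising_one_minus_neq_0.
  - destruct (Z_of_nat_complete m Hm) as [n ->].
    replace (Z.of_nat n + 1)%Z with (Z.of_nat (S n)) by lia.
    now rewrite !poch_nat, <- INR_IZR_INZ.
Qed.

Lemma poch_pred_succ (q : C) (m : Z) :
  not_positive_integer q ->
  poch (q - 1) (m + 1) = (q - 1) * poch q m.
Proof.
  intros H; destruct (Z_lt_le_dec m 0) as [Hm|Hm].
  - assert (E : exists n, m = (- Z.of_nat (S n))%Z).
    { exists (Z.to_nat (- m - 1)); lia. }
    destruct E as [n ->].
    replace (- Z.of_nat (S n) + 1)%Z with (- Z.of_nat n)%Z by lia.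
    rewrite !poch_opp_nat, rising_S_l.
    replace (1 - q + 1) with (1 - (q - 1)) by ring.
    assert (H0 := one_minus_plus_neq_0 q 0 H); simpl in H0; rewrite Cplus_0_r in H0.
    assert (H1 := rising_one_minus_neq_0 _ n (not_positive_integer_pred q H)).
    simpl; rewrite RtoC_m1; field; auto.
  - destruct (Z_of_nat_complete m Hm) as [n ->].
    replace (Z.of_nat n + 1)%Z with (Z.of_nat (S n)) by lia.
    rewrite !poch_nat, rising_S_l; do 2 f_equal; ring.
Qed.

(** [j! * difference_weight j m] is the coefficient of [f m] in the [j]-th
    forward difference of [f] at 0. *)
Definition difference_weight (j m : nat) : C :=
  RtoC (-1) ^ (j - m) / (RtoC (INR (fact m)) * RtoC (INR (fact (j - m)))).

Lemma difference_weight_S (f : nat -> C) (j : nat) :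
  (RtoC (INR j) + 1)
    * lsum (fun m => difference_weight (S j) m * f m) (seq 0 (S (S j)))
  = lsum (fun m => difference_weight j m * f (S m)) (seq 0 (S j))
    + - (1) * lsum (fun m => difference_weight j m * f m) (seq 0 (S j)).
Proof.
  (* Split the factor [j + 1] as [m + (j + 1 - m)]; each part cancels a factor
     of one of the two factorials. *)
  transitivity
    (lsum (fun m => RtoC (INR m) * difference_weight (S j) m * f m) (seq 0 (S (S j)))
     + lsum (fun m => RtoC (INR (S j - m)) * difference_weight (S j) m * f m)
         (seq 0 (S (S j)))).
  - rewrite <- lsum_plus, <- lsum_scal; apply lsum_ext.
    intros m Hm; apply in_seq in Hm.
    rewrite minus_INR, S_INR, RtoC_minus, RtoC_plus by lia; ring.
  - f_equal.
    + change (seq 0 (S (S j))) with (0%nat :: seq 1 (S j)).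
      rewrite <- seq_shift.
      change (lsum ?u (0%nat :: ?l)) with (u 0%nat + lsum u l).
      rewrite lsum_map.
      transitivity (RtoC 0 + lsum (fun m => difference_weight j m * f (S m)) (seq 0 (S j)));
        [|ring].
      f_equal; [simpl; ring|].
      apply lsum_ext; intros m _.
      unfold difference_weight; rewrite fact_S_C, S_INR, RtoC_plus.
      replace (S j - S m)%nat with (j - m)%nat by lia.
      assert (H1 : RtoC (INR m) + 1 <> 0).
      { rewrite <- RtoC_plus; apply RtoC_neq_0; pose proof (pos_INR m); lra. }
      field; auto using INR_fact_C_neq_0.
    + rewrite (seq_S (S j)), lsum_app.
      transitivity (- (1) * lsum (fun m => difference_weight j m * f m) (seq 0 (S j)) + 0);
        [|ring].
      f_equal.
      * rewrite <- lsum_scal; apply lsum_ext; intros m Hm; apply in_seq in Hm.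
        unfold difference_weight.
        replace (S j - m)%nat with (S (j - m)) by lia.
        rewrite fact_S_C, S_INR, RtoC_plus; simpl; rewrite RtoC_m1.
        assert (H1 : RtoC (INR (j - m)) + 1 <> 0).
        { rewrite <- RtoC_plus; apply RtoC_neq_0; pose proof (pos_INR (j - m)); lra. }
        field; auto using INR_fact_C_neq_0.
      * unfold lsum; simpl; rewrite Nat.sub_diag; simpl; ring.
Qed.

(** The coefficient of the Appell series, without the factors that depend on
    [b1] and [b2] and without the factorials. *)
Definition appell_coef (a c : C) (m p : nat) : C :=
  rising (1 - c - a) (m + p) / (rising (1 - c) m * rising (1 - a) p).

Lemma appell_coef_S (a c : C) (m p : nat) :
  not_positive_integer a -> not_positive_integer c ->
  appell_coef a c (S m) p
  = (1 - c - a) / (1 - c) * appell_coef a (c - 1) m p.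
Proof.
  intros Ha Hc; unfold appell_coef.
  change (S m + p)%nat with (S (m + p)); rewrite !rising_S_l.
  replace (1 - c - a + 1) with (1 - (c - 1) - a) by ring.
  replace (1 - c + 1) with (1 - (c - 1)) by ring.
  assert (H0 := one_minus_plus_neq_0 c 0 Hc); simpl in H0; rewrite Cplus_0_r in H0.
  assert (H1 := rising_one_minus_neq_0 _ m (not_positive_integer_pred c Hc)).
  assert (H2 := rising_one_minus_neq_0 _ p Ha).
  field; auto.
Qed.

Definition mixed_difference (a c : C) (j k : nat) : C :=
  lsum (fun m => difference_weight j m
    * lsum (fun p => difference_weight k p * appell_coef a c m p) (seq 0 (S k)))
    (seq 0 (S j)).

Lemma mixed_difference_sym (a c : C) (j k : nat) :
  mixed_difference a c j k = mixed_difference c a k j.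
Proof.
  unfold mixed_difference.
  erewrite lsum_ext by (intros; symmetry; apply lsum_scal).
  rewrite lsum_exchange; apply lsum_ext; intros p _.
  rewrite <- lsum_scal; apply lsum_ext; intros m _.
  unfold appell_coef; rewrite (Nat.add_comm m p), (Cmult_comm (rising (1 - c) m)).
  replace (1 - c - a) with (1 - a - c) by ring; ring.
Qed.

(** Pascal's rule in [j]; shifting [m] by one in the coefficients amounts to
    replacing [c] by [c - 1], up to a constant factor. *)
Lemma mixed_difference_S (a c : C) (j k : nat) :
  not_positive_integer a -> not_positive_integer c ->
  (RtoC (INR j) + 1) * mixed_difference a c (S j) k
  = (1 - c - a) / (1 - c) * mixed_difference a (c - 1) j k - mixed_difference a c j k.
Proof.
  intros Ha Hc; unfold mixed_difference at 1.
  rewrite (difference_weight_S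
    (fun m => lsum (fun p => difference_weight k p * appell_coef a c m p) (seq 0 (S k)))).
  transitivity ((1 - c - a) / (1 - c) * mixed_difference a (c - 1) j k
                + - (1) * mixed_difference a c j k); [|ring].
  f_equal.
  unfold mixed_difference; rewrite <- lsum_scal; apply lsum_ext; intros m _.
  transitivity (difference_weight j m * ((1 - c - a) / (1 - c)
    * lsum (fun p => difference_weight k p * appell_coef a (c - 1) m p) (seq 0 (S k))));
    [|ring].
  f_equal; rewrite <- lsum_scal; apply lsum_ext; intros p _.
  rewrite appell_coef_S by assumption; ring.
Qed.

Definition horn_coef (a c : C) (j k : nat) : C :=
  poch a (Z.of_nat j - Z.of_nat k) * poch c (Z.of_nat k - Z.of_nat j)
  / (RtoC (INR (fact j)) * RtoC (INR (fact k))).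

Lemma horn_coef_sym (a c : C) (j k : nat) : horn_coef a c j k = horn_coef c a k j.
Proof.
  unfold horn_coef; rewrite (Cmult_comm (poch a _)).
  now rewrite (Cmult_comm (RtoC (INR (fact j)))).
Qed.

(** With [n = k - j], both sides are multiples of [(a)_(-n) (c)_(n-1)], and the
    relation between the remaining factors is [a - n = (a + c - 1) - (c + n - 1)]. *)
Lemma horn_coef_S (a c : C) (j k : nat) :
  not_positive_integer a -> not_positive_integer c ->
  (RtoC (INR j) + 1) * horn_coef a c (S j) k
  = (1 - c - a) / (1 - c) * horn_coef a (c - 1) j k - horn_coef a c j k.
Proof.
  intros Ha Hc; unfold horn_coef.
  set (n := (Z.of_nat k - Z.of_nat j)%Z).
  replace (Z.of_nat (S j) - Z.of_nat k)%Z with (- n + 1)%Z by lia.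
  replace (Z.of_nat k - Z.of_nat (S j))%Z with (n - 1)%Z by lia.
  replace (Z.of_nat j - Z.of_nat k)%Z with (- n)%Z by lia.
  rewrite poch_succ by assumption.
  assert (E1 := poch_pred_succ c (n - 1) Hc).
  assert (E2 := poch_succ c (n - 1) Hc).
  replace (n - 1 + 1)%Z with n in E1, E2 by lia.
  rewrite E1, E2, fact_S_C, opp_IZR, minus_IZR, RtoC_opp, RtoC_minus.
  assert (H0 := one_minus_plus_neq_0 c 0 Hc); simpl in H0; rewrite Cplus_0_r in H0.
  assert (H1 : RtoC (INR j) + 1 <> 0).
  { rewrite <- RtoC_plus; apply RtoC_neq_0; pose proof (pos_INR j); lra. }
  field; repeat split; auto using INR_fact_C_neq_0.
Qed.

(** The recurrence lowers [c], so the case [j = 0] has to be known for all [c]. *)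
Lemma mixed_difference_extend (a : C) (k : nat) :
  not_positive_integer a ->
  (forall c, not_positive_integer c -> mixed_difference a c 0 k = horn_coef a c 0 k) ->
  forall j c, not_positive_integer c -> mixed_difference a c j k = horn_coef a c j k.
Proof.
  intros Ha H0 j; induction j as [|j IH]; intros c Hc; [now apply H0|].
  assert (H1 : RtoC (INR j) + 1 <> 0).
  { rewrite <- RtoC_plus; apply RtoC_neq_0; pose proof (pos_INR j); lra. }
  assert (E : (RtoC (INR j) + 1) * mixed_difference a c (S j) k
            = (RtoC (INR j) + 1) * horn_coef a c (S j) k).
  { rewrite mixed_difference_S, horn_coef_S by assumption.
    rewrite !IH by auto using not_positive_integer_pred; reflexivity. }
  rewrite <- (Cmult_1_l (mixed_difference _ _ _ _)), <- (Cmult_1_l (horn_coef _ _ _ _)).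
  rewrite <- (Cinv_l _ H1), <- !Cmult_assoc, E; reflexivity.
Qed.

(** Both sides satisfy the same recurrence in [j] and, by symmetry, in [k].
    This replaces two applications of the Chu-Vandermonde summation, whose
    intermediate quotients degenerate when [a] is a nonpositive integer. *)
Lemma mixed_difference_horn_coef (a c : C) (j k : nat) :
  not_positive_integer a -> not_positive_integer c ->
  mixed_difference a c j k = horn_coef a c j k.
Proof.
  intros Ha Hc; apply mixed_difference_extend; try assumption.
  clear c Hc; intros c Hc; rewrite mixed_difference_sym, horn_coef_sym.
  apply mixed_difference_extend; try assumption.
  clear a Ha; intros a Ha.
  unfold mixed_difference, difference_weight, appell_coef, horn_coef, lsum; simpl.
  field; apply C1_nz.
Qed.

(** * The fourfold expansion *)

(** The term of index [(m, p)] of the right-hand side, with its factors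
    [x^m (1 + x)^(- b1 - m)] and [y^p (1 + y)^(- b2 - p)] expanded; [n] and [q]
    index the two binomial series. *)
Definition expansion_term (a c b1 b2 x y : C) (s : (nat * nat) * (nat * nat)) : C :=
  let '((m, p), (n, q)) := s in
  appell_coef a c m p / (RtoC (INR (fact m)) * RtoC (INR (fact p)))
  * (rising b1 (m + n) * RtoC (-1) ^ n / RtoC (INR (fact n)) * x ^ (m + n))
  * (rising b2 (p + q) * RtoC (-1) ^ q / RtoC (INR (fact q)) * y ^ (p + q)).

(** The binomial coefficient of [m + n] over [m] is at most [2^(m+n)]. *)
Lemma fact_plus_le (m n : nat) :
  (INR (fact (m + n)) <= 2 ^ (m + n) * (INR (fact m) * INR (fact n)))%R.
Proof.
  revert n; induction m as [|m IHm]; intros n.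
  - rewrite Nat.add_0_l; change (INR (fact 0)) with 1%R; rewrite Rmult_1_l.
    assert (H := INR_fact_lt_0 n).
    assert (1 <= 2 ^ n)%R by (apply pow_R1_Rle; lra); nra.
  - induction n as [|n IHn].
    + rewrite Nat.add_0_r; change (INR (fact 0)) with 1%R; rewrite Rmult_1_r.
      assert (H := INR_fact_lt_0 (S m)).
      assert (1 <= 2 ^ S m)%R by (apply pow_R1_Rle; lra); nra.
    + (* Pascal's rule, with the binomial coefficient cleared of denominators. *)
      replace (S m + S n)%nat with (S (m + S n)) by lia.
      rewrite fact_S_R.
      specialize (IHm (S n)).
      replace (S m + n)%nat with (m + S n)%nat in IHn by lia.
      rewrite fact_S_R in IHn |- *; rewrite (fact_S_R n) in *.
      rewrite plus_INR, S_INR; simpl pow.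
      assert (Hm := pos_INR m); assert (Hn := pos_INR n).
      set (F := INR (fact (m + S n))) in *; set (P := (2 ^ (m + S n))%R) in *.
      set (f := INR (fact m)) in *; set (g := INR (fact n)) in *.
      set (u := INR m) in *; set (v := INR n) in *.
      replace ((u + (v + 1) + 1) * F)%R with ((u + 1) * F + (v + 1) * F)%R by ring.
      apply Rle_trans with
        ((u + 1) * (P * (f * ((v + 1) * g))) + (v + 1) * (P * ((u + 1) * f * g)))%R.
      * apply Rplus_le_compat; apply Rmult_le_compat_l; lra.
      * right; ring.
Qed.

Lemma scaled_binomial_bound (b x : C) (K r : R) :
  (0 <= K)%R -> (forall n, (Cmod (rising b n) <= K * 2 ^ n * INR (fact n))%R) ->
  (Cmod x <= r)%R -> forall m n,
  (Cmod (rising b (m + n) * RtoC (-1) ^ n / RtoC (INR (fact n)) * x ^ (m + n))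
   <= K * INR (fact m) * (4 * r) ^ m * (4 * r) ^ n)%R.
Proof.
  intros HK Hb Hx m n; unfold Cdiv.
  rewrite !Cmod_mult, Cmod_inv, !Cmod_pow, Cmod_INR, Cmod_R by apply INR_fact_C_neq_0.
  replace (Rabs (-1)) with 1%R by (rewrite Rabs_left; lra); rewrite pow1, Rmult_1_r.
  assert (Hf := INR_fact_lt_0 n); assert (Hx0 := Cmod_ge_0 x).
  replace (K * INR (fact m) * (4 * r) ^ m * (4 * r) ^ n)%R
    with (K * 2 ^ (m + n) * (2 ^ (m + n) * (INR (fact m) * INR (fact n)))
          * / INR (fact n) * r ^ (m + n))%R.
  - apply Rmult_le_compat.
    + apply Rmult_le_pos; [apply Cmod_ge_0 | left; now apply Rinv_0_lt_compat].
    + now apply pow_le.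
    + apply Rmult_le_compat_r; [left; now apply Rinv_0_lt_compat|].
      eapply Rle_trans; [apply Hb|].
      apply Rmult_le_compat_l; [|apply fact_plus_le].
      apply Rmult_le_pos; [assumption | apply pow_le; lra].
    + now apply pow_incr.
  - replace 4%R with (2 * 2)%R by ring.
    rewrite !Rpow_mult_distr, !pow_add; field; lra.
Qed.

Lemma expansion_term_summable (a c b1 b2 x y : C) :
  not_positive_integer a -> not_positive_integer c ->
  (Cmod x < / 64)%R -> (Cmod y < / 64)%R ->
  bounded_sums (fun s => Cmod (expansion_term a c b1 b2 x y s)).
Proof.
  intros Ha Hc Hx Hy.
  assert (L : (1 < 2)%R) by lra.
  destruct (rising_growth (1 - c - a) 2 L) as [K0 [P0 B0]].
  destruct (rising_growth b1 2 L) as [K1 [P1 B1]].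
  destruct (rising_growth b2 2 L) as [K2 [P2 B2]].
  destruct (rising_inv_growth (1 - c) 2 L
    (fun i => one_minus_plus_neq_0 c i Hc)) as [K3 [P3 B3]].
  destruct (rising_inv_growth (1 - a) 2 L
    (fun i => one_minus_plus_neq_0 a i Ha)) as [K4 [P4 B4]].
  assert (G : bounded_sums (fun n => ((1 / 2) ^ n)%R))
    by (apply bounded_sums_geometric; lra).
  assert (Gpos : forall n, (0 <= (1 / 2) ^ n)%R) by (intros; apply pow_le; lra).
  assert (G2 := bounded_sums_prod _ _ Gpos Gpos G G).
  assert (G2pos : forall i : nat * nat, (0 <= (1 / 2) ^ fst i * (1 / 2) ^ snd i)%R)
    by (intros; now apply Rmult_le_pos).
  assert (G4 := bounded_sums_prod _ _ G2pos G2pos G2 G2).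
  eapply bounded_sums_le;
    [|apply (bounded_sums_scal (K0 * K1 * K2 * K3 * K4)); [|exact G4]];
    [|repeat apply Rmult_le_pos; assumption].
  intros [[m p] [n q]]; unfold expansion_term; cbn [fst snd].
  rewrite !Cmod_mult.
  assert (X1 := scaled_binomial_bound b1 x K1 (/ 64) P1 B1 (Rlt_le _ _ Hx) m n).
  assert (X2 := scaled_binomial_bound b2 y K2 (/ 64) P2 B2 (Rlt_le _ _ Hy) p q).
  rewrite !Cmod_mult in X1, X2.
  assert (Hm := INR_fact_lt_0 m); assert (Hp := INR_fact_lt_0 p).
  assert (X0 : (Cmod (appell_coef a c m p / (RtoC (INR (fact m)) * RtoC (INR (fact p))))
    <= K0 * K3 * K4 * 8 ^ m * 8 ^ p * (/ INR (fact m) * / INR (fact p)))%R).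
  { unfold appell_coef.
    rewrite !Cmod_div, !Cmod_mult, !Cmod_INR;
      auto using Cmult_neq_0, INR_fact_C_neq_0, rising_one_minus_neq_0.
    unfold Rdiv; rewrite !Rinv_mult.
    apply Rmult_le_compat_r.
    { apply Rmult_le_pos; left; now apply Rinv_0_lt_compat. }
    assert (Y0 := B0 (m + p)%nat); assert (Y3 := B3 m); assert (Y4 := B4 p).
    apply Rle_trans with ((K0 * 2 ^ (m + p) * (2 ^ (m + p) * (INR (fact m) * INR (fact p))))
      * ((K3 * 2 ^ m * / INR (fact m)) * (K4 * 2 ^ p * / INR (fact p))))%R.
    - assert (I3 : (0 <= / Cmod (rising (1 - c) m))%R).
      { left; apply Rinv_0_lt_compat, Cmod_gt_0; now apply rising_one_minus_neq_0. }
      assert (I4 : (0 <= / Cmod (rising (1 - a) p))%R).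
      { left; apply Rinv_0_lt_compat, Cmod_gt_0; now apply rising_one_minus_neq_0. }
      apply Rmult_le_compat; [apply Cmod_ge_0 | now apply Rmult_le_pos | |].
      + eapply Rle_trans; [apply Y0|].
        apply Rmult_le_compat_l; [|apply fact_plus_le].
        apply Rmult_le_pos; [assumption | apply pow_le; lra].
      + now apply Rmult_le_compat.
    - right; replace 8%R with (2 * 2 * 2)%R by ring.
      rewrite !Rpow_mult_distr, !pow_add; field; lra. }
  apply Rle_trans with
    (K0 * K3 * K4 * 8 ^ m * 8 ^ p * (/ INR (fact m) * / INR (fact p))
     * (K1 * INR (fact m) * (4 * / 64) ^ m * (4 * / 64) ^ n)
     * (K2 * INR (fact p) * (4 * / 64) ^ p * (4 * / 64) ^ q))%R.
  - apply Rmult_le_compat; try assumption.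
    + repeat apply Rmult_le_pos; apply Cmod_ge_0.
    + repeat apply Rmult_le_pos; apply Cmod_ge_0.
    + apply Rmult_le_compat; try assumption.
      * apply Cmod_ge_0.
      * repeat apply Rmult_le_pos; apply Cmod_ge_0.
  - replace (K0 * K3 * K4 * 8 ^ m * 8 ^ p * (/ INR (fact m) * / INR (fact p))
     * (K1 * INR (fact m) * (4 * / 64) ^ m * (4 * / 64) ^ n)
     * (K2 * INR (fact p) * (4 * / 64) ^ p * (4 * / 64) ^ q))%R
    with (K0 * K1 * K2 * K3 * K4
      * (((8 * (4 * / 64)) ^ m * (8 * (4 * / 64)) ^ p) * ((4 * / 64) ^ n * (4 * / 64) ^ q)))%R
      by (rewrite !Rpow_mult_distr; field; lra).
    (* The radius is chosen so that the ratio in [m] and in [p] is [1 / 2]. *)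
    replace (8 * (4 * / 64))%R with (1 / 2)%R by field.
    apply Rmult_le_compat_l; [repeat apply Rmult_le_pos; assumption|].
    apply Rmult_le_compat_l; [now apply Rmult_le_pos|].
    apply Rmult_le_compat; try (apply pow_le; lra); apply pow_incr; lra.
Qed.

Lemma one_plus_neq_0 (x : C) : (Cmod x < 1)%R -> 1 + x <> 0.
Proof.
  intros Hx E; assert (Ex : x = - (1)).
  { apply Ceq_minus; rewrite <- E; ring. }
  rewrite Ex, Cmod_m1 in Hx; lra.
Qed.

Lemma one_plus_Re_pos (x : C) : (Cmod x < 1)%R -> (0 < Re (1 + x))%R.
Proof.
  intros Hx; assert (H := re_le_Cmod x); rewrite re_plus, re_RtoC.
  assert (B : (Rabs (Re x) < 1)%R) by lra; apply Rabs_lt_between in B; lra.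
Qed.

Lemma has_sum_expansion_row (a c b1 b2 x y : C) (mp : nat * nat) :
  (Cmod x < 1)%R -> (Cmod y < 1)%R ->
  has_sum (fun s => expansion_term a c b1 b2 x y (mp, s))
    (Cpower (1 + x) (- b1) * Cpower (1 + y) (- b2)
     * F2_term (1 - c - a) b1 b2 (1 - c) (1 - a) (x / (x + 1)) (y / (y + 1))
         (fst mp) (snd mp)).
Proof.
  destruct mp as [m p]; intros Hx Hy; cbn [fst snd].
  assert (S := has_sum_prod _ _ _ _
    (binomial_term_summable (b1 + RtoC (INR m)) x Hx)
    (binomial_term_summable (b2 + RtoC (INR p)) y Hy)
    (binomial_series _ _ Hx) (binomial_series _ _ Hy)).
  apply (has_sum_scal (appell_coef a c m p / (RtoC (INR (fact m)) * RtoC (INR (fact p)))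
    * (rising b1 m * x ^ m) * (rising b2 p * y ^ p))) in S.
  match type of S with has_sum _ ?u => match goal with |- has_sum _ ?v =>
    replace v with u end end.
  - eapply has_sum_ext; [|exact S]; intros [n q]; cbn [fst snd].
    unfold expansion_term, binomial_term.
    rewrite !rising_plus, !Cpow_add_r; unfold Cdiv; ring.
  - rewrite <- (Cpower_minus_nat (1 + x) b1 m) by now apply one_plus_Re_pos.
    rewrite <- (Cpower_minus_nat (1 + y) b2 p) by now apply one_plus_Re_pos.
    assert (Nx := Cpow_nz _ m (one_plus_neq_0 x Hx)).
    assert (Ny := Cpow_nz _ p (one_plus_neq_0 y Hy)).
    unfold F2_term, appell_coef.
    rewrite (Cplus_comm x 1), (Cplus_comm y 1).
    unfold Cdiv; rewrite !Cpow_mult_l, !Cpow_inv by now apply one_plus_neq_0.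
    set (X := (1 + x) ^ m) in *; set (Y := (1 + y) ^ p) in *.
    set (U := / (_ * _)); set (V := / (_ * _)).
    field; auto.
Qed.

Lemma NoDup_list_prod {I J : Type} (l : list I) (l' : list J) :
  NoDup l -> NoDup l' -> NoDup (list_prod l l').
Proof.
  intros nd nd'; induction nd as [|i l Hi nd IH]; simpl; [constructor|].
  apply NoDup_app; [|assumption|].
  - apply FinFun.Injective_map_NoDup; [intros j k E; congruence | assumption].
  - intros s Hs Hs'; apply in_map_iff in Hs; destruct Hs as [j [<- _]].
    apply in_prod_iff in Hs'; now destruct Hs'.
Qed.

Definition expansion_fibre (jk : nat * nat) : list ((nat * nat) * (nat * nat)) :=
  map (fun mp => (mp, (fst jk - fst mp, snd jk - snd mp)%nat))
    (list_prod (seq 0 (S (fst jk))) (seq 0 (S (snd jk)))).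

Lemma NoDup_expansion_fibre (jk : nat * nat) : NoDup (expansion_fibre jk).
Proof.
  apply FinFun.Injective_map_NoDup.
  - intros s t E; congruence.
  - apply NoDup_list_prod; apply seq_NoDup.
Qed.

Lemma in_expansion_fibre (jk : nat * nat) (s : (nat * nat) * (nat * nat)) :
  In s (expansion_fibre jk) <->
  (fst (fst s) + fst (snd s), snd (fst s) + snd (snd s))%nat = jk.
Proof.
  destruct jk as [j k], s as [[m p] [n q]]; unfold expansion_fibre; cbn [fst snd].
  rewrite in_map_iff; split.
  - intros [[m' p'] [E H]]; apply in_prod_iff in H; rewrite !in_seq in H.
    cbn [fst snd] in E; injection E; intros; subst; f_equal; lia.
  - intros E; injection E; intros; subst; exists (m, p); cbn [fst snd]; split.
    + do 2 f_equal; lia.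
    + apply in_prod_iff; rewrite !in_seq; lia.
Qed.

Lemma lsum_expansion_fibre (a c b1 b2 x y : C) (j k : nat) :
  not_positive_integer a -> not_positive_integer c ->
  lsum (expansion_term a c b1 b2 x y) (expansion_fibre (j, k))
  = G2_term a c b1 b2 x y j k.
Proof.
  intros Ha Hc.
  transitivity (rising b1 j * rising b2 k * x ^ j * y ^ k * mixed_difference a c j k).
  - unfold expansion_fibre, mixed_difference; cbn [fst snd].
    rewrite lsum_map, lsum_prod, <- lsum_scal; apply lsum_ext; intros m Hm.
    apply in_seq in Hm.
    rewrite <- !lsum_scal; apply lsum_ext; intros p Hp; apply in_seq in Hp.
    cbn [fst snd]; unfold expansion_term, difference_weight.
    replace (m + (j - m))%nat with j by lia.
    replace (p + (k - p))%nat with k by lia.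
    assert (H1 := INR_fact_C_neq_0 m); assert (H2 := INR_fact_C_neq_0 p).
    assert (H3 := INR_fact_C_neq_0 (j - m)); assert (H4 := INR_fact_C_neq_0 (k - p)).
    field; auto.
  - rewrite mixed_difference_horn_coef by assumption.
    unfold horn_coef, G2_term, Cdiv; ring.
Qed.

Theorem mainTheorem4 :
  forall a c b1 b2 : C,
    (forall n : nat, (1 <= n)%nat -> a <> RtoC (INR n)) ->
    (forall n : nat, (1 <= n)%nat -> c <> RtoC (INR n)) ->
    exists r : R, (0 < r)%R /\
    forall x y : C, (Cmod x < r)%R -> (Cmod y < r)%R ->
      ex_sum2 (G2_term a c b1 b2 x y) /\
      ex_sum2 (F2_term (1 - c - a) b1 b2 (1 - c) (1 - a)
                       (x / (x + 1)) (y / (y + 1))) /\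
      G2 a c b1 b2 x y =
        Cpower (1 + x) (- b1) * Cpower (1 + y) (- b2)
        * F2 (1 - c - a) b1 b2 (1 - c) (1 - a) (x / (x + 1)) (y / (y + 1)).
Proof.
  intros a c b1 b2 Ha Hc; exists (/ 64)%R; split; [lra|]; intros x y Hx Hy.
  assert (Hx1 : (Cmod x < 1)%R) by lra; assert (Hy1 : (Cmod y < 1)%R) by lra.
  destruct (has_sum_abs _ (expansion_term_summable a c b1 b2 x y Ha Hc Hx Hy)) as [s Hs].
  assert (HG : has_sum (fun jk => G2_term a c b1 b2 x y (fst jk) (snd jk)) s).
  { eapply has_sum_ext;
      [|exact (has_sum_fibres _ _ _ _ NoDup_expansion_fibre in_expansion_fibre Hs)].
    intros [j k]; now apply lsum_expansion_fibre. }
  assert (HR := has_sum_rows _ _ _ Hs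
    (fun mp => has_sum_expansion_row a c b1 b2 x y mp Hx1 Hy1)).
  set (w := Cpower (1 + x) (- b1) * Cpower (1 + y) (- b2)) in *.
  assert (Hw : w <> 0) by (apply Cmult_neq_0; apply Cexp_neq_0).
  assert (HF : has_sum (fun mp => F2_term (1 - c - a) b1 b2 (1 - c) (1 - a)
                 (x / (x + 1)) (y / (y + 1)) (fst mp) (snd mp)) (/ w * s)).
  { eapply has_sum_ext; [|exact (has_sum_scal (/ w) _ _ HR)].
    intros [m p]; cbn [fst snd]; rewrite Cmult_assoc, Cinv_l, Cmult_1_l by assumption.
    reflexivity. }
  split; [|split].
  - exists s; now apply is_sum2_of_has_sum.
  - exists (/ w * s); now apply is_sum2_of_has_sum.
  - unfold G2, F2; rewrite (Sum2_of_has_sum _ _ HG), (Sum2_of_has_sum _ _ HF).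
    field; assumption.
Qed.
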